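(* Let $k$ be a field of characteristic $p>0$, and let $F=(G,\chi,c,a,\alpha)$ and $F'=(G',\chi',c',a',\alpha')$ be tuples defining (rank one) Hopf algebras $H_F$ and $H_{F'}$ over $k$, where $\alpha=(\alpha_{-1},\alpha_0)$ and $\alpha'=(\alpha_{-1}',\alpha_0')$. If there exists a group isomorphism $f:G\to G'$ with $f(a)=a'$, $\chi=\chi'\circ f$, $c=c'\circ f$ and $\alpha=\alpha'$, then $H_F$ and $H_{F'}$ are isomorphic as Hopf algebras. Conversely, suppose that $H_F$ and $H_{F'}$ are isomorphic Hopf algebras of nilpotent type and that $a$ does not have order $p$. Then there exists a group isomorphism $f:G\to G'$ with $f(a)=a'$ and $\chi=\chi'\circ f$.
   Context: Second type $H_F$. Let $F=(G,\chi,c,a,(\alpha_{-1},\alpha_0))$ where $G$ is a finite group, $a\in Z(G)$, $\chi:G\to k^*$ a linear character with $\chi(a)=1$, $c:G\to k$ a map with $c(hg)=\chi(g)c(h)+c(g)$ for all $g,h\in G$ and $c(a)=0$, and $\alpha_{-1},\alpha_0\in k$ with $\alpha_0\in\{0,1\}$ and $\alpha_{-1}=0$ if $\alpha_0=0$. It is assumed that if $\alpha_0=0$ then $c(g)(a^p-1)=0$ in $kG$ for all $g\in G$; and if $\alpha_0=1$ then $a^p=a$, and for all $g\in G$ one has $\chi(g)\in\mathbb{F}_p^*$ and $(\alpha_{-1}(\chi(g)-1)+c(g)^p-c(g))(a-1)=0$ in $kG$. $H_F$ is the algebra containing $kG$ and an element $x$, with basis $\{gx^i: g\in G,0\le i\le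 p-1\}$ and relations $x^p=\alpha_{-1}(a^p-1)+\alpha_0x$, $gxg^{-1}=\chi(g)x+c(g)(a-1)$ ($g\in G$); its Hopf structure is $\Delta(gx^i)=(g\otimes g)(x\otimes a+1\otimes x)^i$, $\epsilon(gx^i)=\delta_{i,0}$, $S(gx^i)=(-xa^{-1})^ig^{-1}$. It is pointed of rank one with coradical $H_0=kG$ and skew point $a$. Nilpotent type: with $P_{a,1}=\{y:\Delta(y)=y\otimes a+1\otimes y\}$, $H_F$ is of nilpotent type if there is an eigenvector $y\in P_{a,1}\setminus H_0$ of the conjugation action of $a$ with $y^p=0$ ($p$ being the degree of $y$, i.e. the smallest $n$ with $y^n\in\sum_{i<n}H_0y^i$). *)

(* Defs.v *)
From HB Require Import structures.
From mathcomp Require Import all_boot all_order all_algebra all_fingroup all_solvable all_field.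

Set Implicit Arguments.
Unset Strict Implicit.
Unset Printing Implicit Defensive.

Import GRing.Theory.
Local Open Scope ring_scope.

(* Matrices of coordinates with respect to the products of the chosen bases of
   [U] and [V]. [tlift_tens] and [tlift_unique] give the universal property, and
   [tens_mul] the product on the tensor product of two algebras. *)
Definition tensor (k : fieldType) (U V : vectType k) : Type :=
  'M[k]_(\dim {:U}, \dim {:V}).

HB.instance Definition _ (k : fieldType) (U V : vectType k) :=
  Vector.copy (tensor U V) 'M[k]_(\dim {:U}, \dim {:V}).

Definition tens (k : fieldType) (U V : vectType k) (u : U) (v : V) :
    tensor U V :=
  \matrix_(i, j) (coord (vbasis {:U}) i u * coord (vbasis {:V}) j v).

Reserved Notation "u \ox v" (at level 40, left associativity).
Notation "u \ox v" := (tens u v) : ring_scope.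

(* The linear map on [tensor U V] induced by a bilinear map [b]. *)
Definition tlift (k : fieldType) (U V : vectType k) (W : lmodType k)
    (b : U -> V -> W) (t : tensor U V) : W :=
  \sum_i \sum_j t i j *: b (vbasis {:U})`_i (vbasis {:V})`_j.

Section TensorTheory.

Variables (k : fieldType) (U V : vectType k).

Lemma tensDl (u1 u2 : U) (v : V) : (u1 + u2) \ox v = u1 \ox v + u2 \ox v.
Proof. by apply/matrixP=> i j; rewrite !mxE linearD mulrDl. Qed.

Lemma tensDr (u : U) (v1 v2 : V) : u \ox (v1 + v2) = u \ox v1 + u \ox v2.
Proof. by apply/matrixP=> i j; rewrite !mxE linearD mulrDr. Qed.

Lemma tensZl a (u : U) (v : V) : (a *: u) \ox v = a *: (u \ox v).
Proof. by apply/matrixP=> i j; rewrite !mxE linearZ /= mulrA. Qed.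

Lemma tensZr a (u : U) (v : V) : u \ox (a *: v) = a *: (u \ox v).
Proof. by apply/matrixP=> i j; rewrite !mxE linearZ /= mulrCA. Qed.

Lemma tensor_sum (t : tensor U V) :
  t = \sum_i \sum_j t i j *: ((vbasis {:U})`_i \ox (vbasis {:V})`_j).
Proof.
apply/matrixP=> i j; rewrite summxE (bigD1 i) //= summxE (bigD1 j) //=.
have cE (W : vectType k) (m n : 'I_(\dim {:W})) :
  coord (vbasis {:W}) m (vbasis {:W})`_n = (n == m)%:R.
  by rewrite coord_free // (basis_free (vbasisP _)).
rewrite !mxE !cE !eqxx !mulr1 !big1 ?addr0 // => [i' ni'|j' nj'].
  rewrite summxE big1 // => j' _; rewrite !mxE !cE.
  by rewrite (negPf ni') mul0r mulr0.
by rewrite !mxE !cE (negPf nj') !mulr0.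
Qed.

Variable W : lmodType k.

Lemma tlift_is_linear (b : U -> V -> W) : linear (tlift b).
Proof.
move=> a s t; rewrite /tlift scaler_sumr -big_split; apply: eq_bigr => i _ /=.
rewrite scaler_sumr -big_split; apply: eq_bigr => j _ /=.
by rewrite !mxE scalerDl scalerA.
Qed.

HB.instance Definition _ (b : U -> V -> W) :=
  GRing.isLinear.Build k (tensor U V) W *:%R (tlift b) (tlift_is_linear b).

Lemma tlift_tens (b : U -> V -> W) (u : U) (v : V) :
    (forall v', linear (b^~ v')) -> (forall u', linear (b u')) ->
  tlift b (u \ox v) = b u v.
Proof.
move=> bl br.
pose blM v' := GRing.isLinear.Build _ _ _ _ _ (bl v').
pose blL v' : {linear U -> W} := HB.pack (b^~ v') (blM v').
pose brM u' := GRing.isLinear.Build _ _ _ _ _ (br u').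
pose brL u' : {linear V -> W} := HB.pack (b u') (brM u').
rewrite {2}(coord_vbasis (memvf u)) -[b _ v]/(blL v _) linear_sum /=.
apply: eq_bigr => i _; rewrite -[b _ v]/(blL v _) linearZ /=.
rewrite {2}(coord_vbasis (memvf v)) -[b _ (\sum__ _)]/(brL _ _) linear_sum /=.
rewrite scaler_sumr; apply: eq_bigr => j _.
by rewrite -[b _ (_ *: _)]/(brL _ _) linearZ /= !mxE scalerA.
Qed.

Lemma tlift_linb (b b1 b2 : U -> V -> W) c (t : tensor U V) :
    (forall u v, b u v = c *: b1 u v + b2 u v) ->
  tlift b t = c *: tlift b1 t + tlift b2 t.
Proof.
move=> bE; rewrite /tlift scaler_sumr -big_split; apply: eq_bigr => i _ /=.
rewrite scaler_sumr -big_split; apply: eq_bigr => j _ /=.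
by rewrite bE scalerDr !scalerA mulrC.
Qed.

Lemma tlift_unique (f g : {linear tensor U V -> W}) :
  (forall u v, f (u \ox v) = g (u \ox v)) -> f =1 g.
Proof.
move=> fg t; rewrite [t]tensor_sum !linear_sum; apply: eq_bigr => i _.
by rewrite !linear_sum; apply: eq_bigr => j _; rewrite !linearZ /= fg.
Qed.

End TensorTheory.

Section TensorAlgebra.

Variables (k : fieldType) (A B : falgType k).
Implicit Types s t r : tensor A B.

Definition tmul s t : tensor A B :=
  tlift (fun a b => tlift (fun a' b' => (a * a') \ox (b * b')) t) s.

Lemma tmulDl : left_distributive tmul +%R.
Proof. by move=> s1 s2 t; rewrite /tmul linearD. Qed.

Lemma tmulZl c s t : tmul (c *: s) t = c *: tmul s t.
Proof. by rewrite /tmul linearZ. Qed.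

Lemma tmul_linear_r s : linear (tmul s).
Proof. by move=> c t1 t2; apply: tlift_linb => a b; rewrite linearP. Qed.

Lemma tmul_linear_l t : linear (tmul^~ t).
Proof. by move=> c s1 s2; rewrite tmulDl tmulZl. Qed.

Lemma tmulDr : right_distributive tmul +%R.
Proof.
by move=> s t1 t2; have := tmul_linear_r s 1 t1 t2; rewrite !scale1r.
Qed.

Lemma tmulZr c s t : tmul s (c *: t) = c *: tmul s t.
Proof.
have s0 : tmul s 0 = 0 by apply: (@addrI _ (tmul s 0)); rewrite -tmulDr !addr0.
by have := tmul_linear_r s c t 0; rewrite s0 !addr0.
Qed.

Lemma tens_tmul (a a' : A) (b b' : B) :
  tmul (a \ox b) (a' \ox b') = (a * a') \ox (b * b').
Proof.
have inner x y : tlift (fun a' b' => (x * a') \ox (y * b')) (a' \ox b')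
    = (x * a') \ox (y * b').
  apply: tlift_tens => [v|u] c z z'.
    by rewrite mulrDr -scalerAr tensDl tensZl.
  by rewrite mulrDr -scalerAr tensDr tensZr.
rewrite /tmul tlift_tens ?inner // => [v|u] c z z'; rewrite !tlift_tens;
  try (by move=> ? ? ? ?; rewrite mulrDr -scalerAr ?tensDl ?tensZl ?tensDr ?tensZr).
- by rewrite mulrDl -scalerAl tensDl tensZl.
- by rewrite mulrDl -scalerAl tensDr tensZr.
Qed.

Definition tone : tensor A B := 1 \ox 1.

Lemma tens_eq_lin (f g : tensor A B -> tensor A B) :
  linear f -> linear g -> (forall a b, f (a \ox b) = g (a \ox b)) -> f =1 g.
Proof.
move=> fl gl.
pose fM := GRing.isLinear.Build _ _ _ _ _ fl.
pose fL : {linear tensor A B -> tensor A B} := HB.pack f fM.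
pose gM := GRing.isLinear.Build _ _ _ _ _ gl.
pose gL : {linear tensor A B -> tensor A B} := HB.pack g gM.
exact: (@tlift_unique _ _ _ _ fL gL).
Qed.

Lemma tmulA : associative tmul.
Proof.
move=> s t r; move: s; apply: tens_eq_lin.
- exact: tmul_linear_l.
- by move=> c s1 s2; rewrite !tmul_linear_l.
move=> a b; move: t; apply: tens_eq_lin.
- by move=> c s1 s2; rewrite tmul_linear_l tmul_linear_r.
- by move=> c s1 s2; rewrite tmul_linear_r tmul_linear_l.
move=> a' b'; move: r; apply: tens_eq_lin.
- by move=> c s1 s2; rewrite !tmul_linear_r.
- by move=> c s1 s2; rewrite !tmul_linear_r.
by move=> a'' b''; rewrite !tens_tmul !mulrA.
Qed.

Lemma tmul1l : left_id tone tmul.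
Proof.
apply: tens_eq_lin => [||a b]; first exact: tmul_linear_r.
  by move=> c s t.
by rewrite tens_tmul !mul1r.
Qed.

Lemma tmul1r : right_id tone tmul.
Proof.
apply: tens_eq_lin => [||a b]; first exact: tmul_linear_l.
  by move=> c s t.
by rewrite tens_tmul !mulr1.
Qed.

Lemma tone_neq0 : tone != 0.
Proof.
have nz (C : falgType k) : exists i, coord (vbasis {:C}) i 1 != 0.
  apply/existsP; apply: contraT; rewrite negb_exists => /forallP z.
  case/eqP: (oner_neq0 C); rewrite (coord_vbasis (memvf 1)) big1 // => i _.
  by move/negPn/eqP: (z i) => ->; rewrite scale0r.
have [[i ni] [j nj]] := (nz A, nz B).
apply/eqP=> /matrixP/(_ i j)/eqP; rewrite !mxE mulf_eq0.
by rewrite (negPf ni) (negPf nj).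
Qed.

HB.instance Definition _ := GRing.Zmodule_isNzRing.Build (tensor A B)
  tmulA tmul1l tmul1r tmulDl tmulDr tone_neq0.

HB.instance Definition _ := GRing.Lmodule_isLalgebra.Build k (tensor A B)
  (fun c s t => esym (tmulZl c s t)).

HB.instance Definition _ := GRing.Lalgebra_isAlgebra.Build k (tensor A B)
  (fun c s t => esym (tmulZr c s t)).

Lemma tens_mul (a a' : A) (b b' : B) :
  (a \ox b) * (a' \ox b') = (a * a') \ox (b * b').
Proof. exact: tens_tmul. Qed.

Lemma tens_one : 1 \ox 1 = 1 :> tensor A B.
Proof. by []. Qed.

End TensorAlgebra.

Definition tmap (k : fieldType) (U V U' V' : vectType k)
    (f : U -> U') (g : V -> V') : tensor U V -> tensor U' V' :=
  tlift (fun u v => f u \ox g v).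

Lemma tmap_tens (k : fieldType) (U V U' V' : vectType k)
    (f : {linear U -> U'}) (g : {linear V -> V'}) (u : U) (v : V) :
  tmap f g (u \ox v) = f u \ox g v.
Proof.
by apply: tlift_tens => [v'|u'] c z z'; rewrite linearP ?tensDl ?tensZl ?tensDr ?tensZr.
Qed.

Definition tassoc (k : fieldType) (U V W : vectType k) :
    tensor (tensor U V) W -> tensor U (tensor V W) :=
  tlift (fun t w => tlift (fun u v => u \ox (v \ox w)) t).

Lemma tassoc_tens (k : fieldType) (U V W : vectType k) (u : U) (v : V) (w : W) :
  tassoc ((u \ox v) \ox w) = u \ox (v \ox w).
Proof.
have inner w' (u' : U) (v' : V) :
    tlift (fun u v => u \ox (v \ox w')) (u' \ox v') = u' \ox (v' \ox w').
  by apply: tlift_tens => [y|y] c z z'; rewrite ?tensDl ?tensZl ?tensDr ?tensZr.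
rewrite /tassoc tlift_tens ?inner // => [w'|t] c z z'; first by rewrite linearP.
by apply: tlift_linb => y y'; rewrite !tensDr !tensZr.
Qed.

HB.mixin Record isHopfAlgebra (k : fieldType) H of Falgebra k H := {
  comul : {lrmorphism H -> tensor H H};
  counit : {lrmorphism H -> k^o};
  antipode : {linear H -> H};
  comulA : forall h : H,
    tassoc (tmap comul idfun (comul h)) = tmap idfun comul (comul h);
  counitl : forall h : H, tlift (fun u v => counit u *: v) (comul h) = h;
  counitr : forall h : H, tlift (fun u v => counit v *: u) (comul h) = h;
  antipodel : forall h : H,
    tlift (fun u v => antipode u * v) (comul h) = (counit h)%:A;
  antipoder : forall h : H,
    tlift (fun u v => u * antipode v) (comul h) = (counit h)%:A
}.

#[short(type="hopfAlgType")]
HB.structure Definition HopfAlgebra (k : fieldType) :=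
  { H of Falgebra k H & isHopfAlgebra k H }.

Arguments comul {k H} : rename.
Arguments counit {k H} : rename.
Arguments antipode {k H} : rename.

Definition hopf_isomorphic (k : fieldType) (H H' : hopfAlgType k) : Prop :=
  exists phi : {lrmorphism H -> H'},
    [/\ bijective phi,
        forall h, comul (phi h) = tmap phi phi (comul h),
        forall h, counit (phi h) = counit h
      & forall h, antipode (phi h) = phi (antipode h)].

(* The element [g] of the group algebra kG, realised as the space of functions
   [G -> k]; only its linear structure is needed. *)
Definition grpalg_elt (k : fieldType) (G : finGroupType) (g : G) :
    {ffun G -> k^o} :=
  [ffun h => (h == g)%:R].

Record datum (k : fieldType) (G : finGroupType) := Datum {
  d_chi : G -> k;
  d_c : G -> k;
  d_a : G;
  d_alpha : k * k  (* (alpha_{-1}, alpha_0) *)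
}.

Record datum_axioms (k : fieldType) (p : nat) (G : finGroupType)
    (F : datum k G) : Prop := DatumAxioms {
  da_central : d_a F \in ('Z([set: G]))%g;
  da_chi_neq0 : forall g, d_chi F g != 0;
  da_chiM : forall g h, d_chi F (g * h)%g = d_chi F g * d_chi F h;
  da_chi_a : d_chi F (d_a F) = 1;
  da_c : forall g h, d_c F (h * g)%g = d_chi F g * d_c F h + d_c F g;
  da_c_a : d_c F (d_a F) = 0;
  da_alpha0 : (d_alpha F).2 = 0 \/ (d_alpha F).2 = 1;
  da_alphaN1 : (d_alpha F).2 = 0 -> (d_alpha F).1 = 0;
  da_case0 : (d_alpha F).2 = 0 -> forall g,
    d_c F g *: (grpalg_elt k (d_a F ^+ p)%g - grpalg_elt k 1%g) = 0;
  da_case1_a : (d_alpha F).2 = 1 -> (d_a F ^+ p)%g = d_a F;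
  (* chi takes values in the nonzero elements of the prime subfield of k *)
  da_case1_chi : (d_alpha F).2 = 1 -> forall g,
    exists2 m : nat, (0 < m < p)%N & d_chi F g = m%:R;
  da_case1_c : (d_alpha F).2 = 1 -> forall g,
    ((d_alpha F).1 * (d_chi F g - 1) + d_c F g ^+ p - d_c F g) *:
      (grpalg_elt k (d_a F) - grpalg_elt k 1%g) = 0
}.

(* [HF_axioms p F iota x]: the Hopf algebra [H], with the group [G] embedded by
   [iota] and the element [x], is H_F. These data determine [H] up to a unique
   isomorphism preserving [iota] and [x]. *)
Record HF_axioms (k : fieldType) (p : nat) (G : finGroupType) (F : datum k G)
    (H : hopfAlgType k) (iota : G -> H) (x : H) : Prop := HFAxioms {
  HF_iota1 : iota 1%g = 1;
  HF_iotaM : forall g h, iota (g * h)%g = iota g * iota h;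
  HF_basis : basis_of {:H} [seq iota u.1 * x ^+ u.2 | u : G * 'I_p];
  HF_xp : x ^+ p =
    (d_alpha F).1 *: (iota (d_a F) ^+ p - 1) + (d_alpha F).2 *: x;
  HF_conj : forall g,
    iota g * x * iota g^-1%g = d_chi F g *: x + d_c F g *: (iota (d_a F) - 1);
  HF_comul : forall g (i : 'I_p), comul (iota g * x ^+ i) =
    (iota g \ox iota g) * (x \ox iota (d_a F) + 1 \ox x) ^+ i;
  HF_counit : forall g (i : 'I_p),
    counit (iota g * x ^+ i) = ((i : nat) == 0%N)%:R;
  HF_antipode : forall g (i : 'I_p), antipode (iota g * x ^+ i) =
    (- (x * iota (d_a F)^-1%g)) ^+ i * iota g^-1%g
}.

Record HFType (k : fieldType) (p : nat) (G : finGroupType) (F : datum k G) :=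
  HFPack {
  HF_hopf :> hopfAlgType k;
  HF_grp : G -> HF_hopf;
  HF_gen : HF_hopf;
  HF_ax : HF_axioms p F HF_grp HF_gen
}.

Section NilpotentType.

Variables (k : fieldType) (p : nat) (G : finGroupType) (F : datum k G).
Variable H : HFType p F.
Let iota : G -> H := HF_grp H.

(* The coradical H_0 = kG of H_F. *)
Definition HF_corad : {vspace H} := <<[seq iota g | g : G]>>%VS.

(* [P_{a,1}], for the skew point [a] *)
Definition skew_prim (y : H) : Prop :=
  comul y = y \ox iota (d_a F) + 1 \ox y.

(* [y ^+ n] lies in the left [H_0]-span of the lower powers of [y] *)
Definition power_dep (y : H) (n : nat) : Prop :=
  exists2 s : nat -> H, (forall i, s i \in HF_corad) &
    y ^+ n = \sum_(i < n) s i * y ^+ i.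

Definition skew_degree (y : H) (n : nat) : Prop :=
  power_dep y n /\ forall m, power_dep y m -> (n <= m)%N.

Definition nilpotent_type : Prop :=
  exists2 y : H, skew_prim y /\ y \notin HF_corad &
    [/\ exists q : k, iota (d_a F) * y * iota (d_a F)^-1%g = q *: y,
        skew_degree y p
      & y ^+ p = 0].

End NilpotentType.

(* Main.v *)
Require Import Defs.
From HB Require Import structures.
From mathcomp Require Import all_boot all_order all_algebra all_fingroup all_solvable all_field.

Set Implicit Arguments.
Unset Strict Implicit.
Unset Printing Implicit Defensive.

Import GRing.Theory.
Local Open Scope ring_scope.

(** The algebra H_F has the basis g x^i (g in G, i < p), and its structure maps
    are determined by their values on kG and on x.

    An isomorphism f : G -> G' that respects the data therefore induces the
    linear map g x^i |-> f(g) x'^i, and multiplicativity only has to be checked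
    for left multiplication by g and by x ([datum_morphism_lrmorphism]): there
    it amounts to the conjugation relation and to the formula for x^p.  The
    inverse of f induces the inverse map.

    Conversely the group and the pair (a, chi) can be read off the coalgebra and
    the conjugation action of H_F.  As a commutes with x, the binomial formula
    gives
<<
      Delta (g x^i) = sum_j C(i, j) g x^j \ox g a^j x^(i - j)
>>
    where C(i, 1) = i is nonzero in k for 0 < i < p.  Comparing coordinates on
    both sides of Delta y = y \ox y shows that the nonzero solutions are exactly
    the elements of G ([grouplike_HF]): an isomorphism H_F -> H_F' restricts to
    an isomorphism f : G -> G'.  The same comparison for
    Delta y = y \ox b + 1 \ox y shows that y lies in kG, unless b = a and
    y = u + nu x with u in kG and nu != 0 ([skew_primitive_HF]).  The image of x
    is such an element for b = f(a), outside kG', so f(a) = a'.  Finally,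
    conjugation by g multiplies the coefficient of x in u + nu x by
    chi(g) ([HF_coord_conj]), so that chi = chi' o f. *)

(** * Linear maps defined on a finite basis *)

Section BasisFamily.

Variables (k : fieldType) (V : vectType k) (W : lmodType k) (I : finType).
Variable e : I -> V.
Hypothesis e_basis : basis_of {:V} [seq e u | u : I].

Lemma basis_lin (w : I -> W) : {f : {linear V -> W} | forall u, f (e u) = w u}.
Proof.
have [f fE] := linear_of_free [seq e u | u : I] [seq w u | u : I].
exists f => u; have := fE (basis_free e_basis).
rewrite !size_image => /(_ erefl); rewrite -map_comp => /eq_in_map.
by apply; apply: mem_enum.
Qed.

Lemma basis_lin_ext (f g : {linear V -> W}) :
  (forall u, f (e u) = g (e u)) -> f =1 g.
Proof.
move=> fg v; have : v \in <<[seq e u | u : I]>>%VS.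
  by rewrite (span_basis e_basis) memvf.
case/(coord_span (X := in_tuple _)) => {1 2}->; rewrite !linear_sum.
apply: eq_bigr => i _; rewrite !linearZ /=; congr (_ *: _).
have /imageP[u _ ->] : [seq e u | u : I]`_i \in [seq e u | u : I].
  by rewrite mem_nth.
exact: fg.
Qed.

End BasisFamily.

(** * Tensor products of linear maps *)

HB.instance Definition _ (k : fieldType) (U V U' V' : vectType k)
    (f : U -> U') (g : V -> V') :=
  GRing.Linear.copy (tmap f g) (tlift (fun u v => f u \ox g v)).

Lemma tens_exp (k : fieldType) (A B : falgType k) (u : A) (v : B) n :
  (u \ox v) ^+ n = (u ^+ n) \ox (v ^+ n).
Proof. by elim: n => [//|n IHn]; rewrite !exprS IHn tens_mul. Qed.

Lemma can_comul (k : fieldType) (H H' : hopfAlgType k)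
    (phi : {linear H -> H'}) (psi : {linear H' -> H}) :
    cancel phi psi -> cancel psi phi ->
    (forall h, comul (phi h) = tmap phi phi (comul h)) ->
  forall h, comul (psi h) = tmap psi psi (comul h).
Proof.
move=> phiK psiK phi_comul h; rewrite -{2}[h]psiK phi_comul.
move: (comul _) => t.
apply: (tlift_unique (f := idfun) (g := tmap psi psi \o tmap phi phi)) => u v.
by rewrite /= !tmap_tens !phiK.
Qed.

(** * The coalgebra H_F in coordinates *)

Section RankOneHopf.

Variables (k : fieldType) (p : nat) (G : finGroupType) (F : datum k G).
Variable H : HFType p F.
Hypotheses (charp : p \in [pchar k]) (HaxF : datum_axioms p F).
Local Notation iota := (HF_grp H).
Local Notation x := (HF_gen H).
Local Notation a := (d_a F).
Local Notation ax := (HF_ax H).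

Lemma HF_ext (W : lmodType k) (f g : {linear H -> W}) :
  (forall h (i : 'I_p), f (iota h * x ^+ i) = g (iota h * x ^+ i)) -> f =1 g.
Proof. by move=> fg; apply: (basis_lin_ext (HF_basis ax)) => -[h i]. Qed.

Lemma p_gt1 : (1 < p)%N.
Proof. exact/prime_gt1/(pcharf_prime charp). Qed.

Lemma HF_iotaV g : iota g * iota g^-1%g = 1.
Proof. by rewrite -(HF_iotaM ax) mulgV (HF_iota1 ax). Qed.

Lemma HF_iotaX g n : iota (g ^+ n)%g = iota g ^+ n.
Proof.
elim: n => [|n IHn]; first by rewrite expg0 expr0 (HF_iota1 ax).
by rewrite expgS exprS (HF_iotaM ax) IHn.
Qed.

Lemma HF_gen_iota g :
  x * iota g = iota g *
    (d_chi F g^-1%g *: x + d_c F g^-1%g *: (iota a - 1)).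
Proof. by rewrite -(HF_conj ax) invgK !mulrA HF_iotaV mul1r. Qed.

Lemma HF_gen_a : x * iota a = iota a * x.
Proof.
have := HF_conj ax a; rewrite (da_chi_a HaxF) (da_c_a HaxF) scale1r scale0r.
rewrite addr0 => E; rewrite -{1}E -mulrA -(HF_iotaM ax) mulVg (HF_iota1 ax).
by rewrite mulr1.
Qed.

(** The binomial formula applies because x commutes with a, so that x \ox a
    commutes with 1 \ox x. *)
Lemma HF_comul_expand h (i : 'I_p) : comul (iota h * x ^+ i) =
  \sum_(j < i.+1) 'C(i, j)%:R *:
     ((iota h * x ^+ j) \ox (iota (h * a ^+ j)%g * x ^+ (i - j))).
Proof.
rewrite (HF_comul ax) addrC exprDn_comm; last first.
  by rewrite /GRing.comm !tens_mul mulr1 mul1r HF_gen_a.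
rewrite mulr_sumr; apply: eq_bigr => j _; rewrite !tens_exp expr1n.
rewrite tens_mul mul1r mulrnAr -scaler_nat tens_mul.
congr (_ *: (_ \ox _)).
rewrite (HF_iotaM ax) HF_iotaX -!mulrA; congr (_ * _).
by apply: commrX; apply/commr_sym/commrX; rewrite /GRing.comm HF_gen_a.
Qed.

(** The second index ranges over all natural numbers, with value 0 from p on, so
    that sums i + j of exponents can be used without a bound. *)
Definition HF_coord (g : G) (i : nat) : {linear H -> k^o} :=
  sval (basis_lin (HF_basis ax)
    (fun u : G * 'I_p => ((u.1 == g) && (u.2 == i :> nat))%:R : k^o)).

Lemma HF_coordE g i h j : (j < p)%N ->
  HF_coord g i (iota h * x ^+ j) = ((h == g) && (j == i))%:R.
Proof.
move=> ltjp; rewrite /HF_coord; case: basis_lin => f /= fE.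
exact: (fE (h, Ordinal ltjp)).
Qed.

Lemma HF_coord_iota g i h : HF_coord g i (iota h) = ((h == g) && (i == 0%N))%:R.
Proof.
by have := HF_coordE g i h (ltnW p_gt1); rewrite expr0 mulr1 [0%N == _]eq_sym.
Qed.

Lemma HF_coord_gt g i y : (p <= i)%N -> HF_coord g i y = 0.
Proof.
move=> lepi; apply: (HF_ext (f := HF_coord g i) (g := \0)) => h j /=.
by rewrite HF_coordE // (ltn_eqF (leq_trans (ltn_ord j) lepi)) andbF.
Qed.

Lemma HF_coord_expand y :
  y = \sum_(g : G) \sum_(i < p) (HF_coord g i y : k) *: (iota g * x ^+ i).
Proof.
pose S z := \sum_(g : G) \sum_(i < p) (HF_coord g i z : k) *: (iota g * x ^+ i).
have Slin : linear S.
  move=> b u v; rewrite /S scaler_sumr -big_split; apply: eq_bigr => g _ /=.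
  rewrite scaler_sumr -big_split; apply: eq_bigr => i _ /=.
  by rewrite linearP scalerDl scalerA.
pose SM := GRing.isLinear.Build _ _ _ _ _ Slin.
pose SL : {linear H -> H} := HB.pack S SM.
apply: (HF_ext (f := idfun) (g := SL)) => h i /=.
rewrite /S (bigD1 h) //= (bigD1 i) //= HF_coordE // !eqxx scale1r.
rewrite !big1 ?addr0 // => [g ngh|j nji].
  by rewrite big1 // => j _; rewrite HF_coordE // eq_sym (negPf ngh) scale0r.
by rewrite HF_coordE // val_eqE [_ == j]eq_sym (negPf nji) andbF scale0r.
Qed.

Definition HF_coord2 g i h j (t : tensor H H) : k^o :=
  tlift (fun u v => HF_coord g i u * HF_coord h j v) t.

HB.instance Definition _ g i h j :=
  GRing.Linear.copy (HF_coord2 g i h j)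
    (tlift (fun u v : H => HF_coord g i u * HF_coord h j v : k^o)).

Lemma HF_coord2_tens g i h j u v :
  HF_coord2 g i h j (u \ox v) = HF_coord g i u * HF_coord h j v.
Proof.
rewrite /HF_coord2 tlift_tens // => z b s t /=.
  by rewrite linearP mulrDl -scalerAl.
by rewrite linearP mulrDr -scalerAr.
Qed.

(** By linearity y = b x^m; the term g x^i \ox h x^j then occurs in the
    expansion of Delta (b x^m) only if b = g, m = i + j and h = g a^i. *)
Lemma HF_coord2_comul g i h j y :
  HF_coord2 g i h j (comul y) =
    'C(i + j, i)%:R * (h == g * a ^+ i)%g%:R * HF_coord g (i + j) y.
Proof.
move: y; pose s : k := 'C(i + j, i)%:R * (h == g * a ^+ i)%g%:R.
apply: (HF_ext (f := HF_coord2 g i h j \o comul)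
               (g := s \*: HF_coord g (i + j))) => b m /=.
rewrite HF_comul_expand linear_sum HF_coordE // /s /=.
under eq_bigr => n _.
  have ltnp : (n < p)%N by apply: leq_trans (ltn_ord m); rewrite ltnS -ltnS.
  rewrite linearZ /= HF_coord2_tens !HF_coordE //; last first.
    exact: leq_ltn_trans (leq_subr _ _) _.
  over.
have [leim|ltmi] := leqP i m; last first.
  rewrite big1 => [|n _]; last first.
    have -> : (val n == i) = false.
      by apply/ltn_eqF/(leq_trans (ltn_ord n)).
    by rewrite andbF mul0r scaler0.
  rewrite (_ : (m == i + j :> nat) = false) ?andbF ?scaler0 //.
  by apply/ltn_eqF/(leq_trans ltmi)/leq_addr.
have ltim : (i < m.+1)%N by [].
rewrite (bigD1 (Ordinal ltim)) //= big1 ?addr0 => [|n nni]; last first.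
  rewrite (_ : (val n == i) = false) ?andbF ?mul0r ?scaler0 //.
  by apply: contraNF nni => /eqP ni; apply/eqP/val_inj.
rewrite eqxx andbT -[(m - i)%N == j](eqn_add2l i) subnKC //.
case: (b =P g) => [->|_] /=; last by rewrite mul0r !scaler0.
rewrite mul1r [(h == _)%g]eq_sym.
case: (val m =P (i + j)%N) => [->|_]; last by rewrite andbF !scaler0.
by rewrite andbT /= /GRing.scale /= mulr1.
Qed.

Lemma HF_coord_low y :
    (forall g i, (0 < i)%N -> HF_coord g i y = 0) ->
  y = \sum_g (HF_coord g 0 y : k) *: iota g.
Proof.
move=> y_low; rewrite [LHS]HF_coord_expand; apply: eq_bigr => g _.
rewrite (bigD1 (Ordinal (ltnW p_gt1))) //= mulr1 big1 ?addr0 // => i.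
by rewrite -val_eqE /= -lt0n => i0; rewrite y_low ?scale0r.
Qed.

Lemma HF_iota_inj : injective iota.
Proof.
move=> g h /(congr1 (HF_coord h 0)); rewrite !HF_coord_iota !eqxx !andbT.
by case: eqP => // _ /esym/eqP; rewrite oner_eq0.
Qed.

Lemma HF_iota_neq0 g : iota g != 0.
Proof.
apply/eqP => /(congr1 (HF_coord g 0)); rewrite HF_coord_iota linear0.
by rewrite !eqxx => /eqP; rewrite oner_eq0.
Qed.

Lemma HF_comul_iota g : comul (iota g) = iota g \ox iota g.
Proof.
by have := HF_comul ax g (Ordinal (ltnW p_gt1)); rewrite /= !expr0 !mulr1.
Qed.

Lemma HF_comul_gen : comul x = x \ox iota a + 1 \ox x.
Proof.
have := HF_comul ax 1%g (Ordinal p_gt1).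
by rewrite /= !expr1 (HF_iota1 ax) mul1r tens_one mul1r.
Qed.

(** The square of the coordinate of y at g x^i, i > 0, is a multiple of its
    coordinate at g x^(2 i), so a nonzero one would leave no largest such i;
    hence y lies in kG, where distinct elements of G have orthogonal
    coordinates. *)
Lemma grouplike_HF y : y != 0 -> comul y = y \ox y -> exists g, y = iota g.
Proof.
move=> y0 yG.
have E g i h j :
    HF_coord g i y * HF_coord h j y =
    'C(i + j, i)%:R * (h == g * a ^+ i)%g%:R * HF_coord g (i + j) y.
  by rewrite -HF_coord2_comul yG HF_coord2_tens.
(* Downward induction on i, from i >= p. *)
have high n g i : (0 < i)%N -> (p <= i + n)%N -> HF_coord g i y = 0.
  elim: n i => [|n IHn] i i0 pin; first by rewrite HF_coord_gt // -[i]addn0.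
  apply/eqP; rewrite -[_ == 0]orbb -mulf_eq0 E [HF_coord _ _ _]IHn ?mulr0 //.
    by rewrite addn_gt0 i0.
  by apply: leq_trans pin _; rewrite addnS -addSn leq_add2r -addn1 leq_add2l.
have yE : y = \sum_g (HF_coord g 0 y : k) *: iota g.
  by apply: HF_coord_low => g i i0; rewrite (high p) ?leq_addl.
have [g g0] : exists g, HF_coord g 0 y != 0.
  apply/existsP; apply: contraNT y0; rewrite negb_exists => /forallP z.
  by rewrite yE big1 // => g _; move/negPn/eqP: (z g) => ->; rewrite scale0r.
exists g; rewrite yE (bigD1 g) //= big1 => [|h nhg]; last first.
  apply/eqP; rewrite scaler_eq0 -(mulrI_eq0 _ (mulfI g0)) E.
  by rewrite expg0 mulg1 (negPf nhg) mulr0 mul0r eqxx.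
have := E g 0%N g 0%N; rewrite bin0 expg0 mulg1 eqxx !mul1r => /(canRL (mulfK g0)).
by rewrite divff // addr0 => ->; rewrite scale1r.
Qed.

(** For i > 1 the term g x \ox g a x^(i - 1) occurs in Delta (g x^i) with the
    coefficient i != 0, but cannot occur in y \ox b + 1 \ox y; the
    terms g x \ox g a and g \ox g x then force g = 1 and b = a for i = 1. *)
Lemma skew_primitive_HF b y : comul y = y \ox iota b + 1 \ox y ->
  (forall g i, (0 < i)%N -> HF_coord g i y = 0) \/
  [/\ b = a, HF_coord 1%g 1 y != 0 &
     y = \sum_g (HF_coord g 0 y : k) *: iota g + (HF_coord 1%g 1 y : k) *: x].
Proof.
move=> yP.
have E g i h j :
    'C(i + j, i)%:R * (h == g * a ^+ i)%g%:R * HF_coord g (i + j) y =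
    HF_coord g i y * ((b == h) && (j == 0%N))%:R
    + ((1%g == g) && (i == 0%N))%:R * HF_coord h j y.
  rewrite -HF_coord2_comul yP linearD /= !HF_coord2_tens.
  by rewrite -(HF_iota1 ax) !HF_coord_iota.
(* The coordinate at (g x) \ox (g a x^(i - 1)). *)
have high g i : (1 < i)%N -> HF_coord g i y = 0.
  move=> i1; have [lepi|ltip] := leqP p i; first exact: HF_coord_gt.
  have := E g 1%N (g * a)%g i.-1.
  rewrite expg1 eqxx add1n prednK ?(ltnW i1) // bin1 mulr1 andbF mul0r addr0.
  rewrite -[i.-1 == 0%N]negbK -lt0n -ltnS prednK ?(ltnW i1) // i1 andbF mulr0.
  move/eqP; rewrite mulf_eq0 -(dvdn_pcharf charp) => /orP[dvdpi|/eqP//].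
  by have := dvdn_leq (ltnW i1) dvdpi; rewrite leqNgt ltip.
(* The coordinate at g \ox (g x). *)
have low g : g != 1%g -> HF_coord g 1 y = 0.
  move=> g1; have := E g 0%N g 1%N.
  rewrite expg0 mulg1 eqxx bin0 add0n !mul1r andbF mulr0 add0r.
  by rewrite eq_sym (negPf g1) mul0r.
have [nu0|nu0] := eqVneq (HF_coord 1%g 1 y) 0.
  left=> g [//|[|i]] _; last exact: high.
  by have [->|/low] := eqVneq g 1%g.
right; split=> //.
  (* The coordinate at x \ox a. *)
  have := E 1%g 1%N a 0%N; rewrite expg1 mul1g eqxx addn0 binn !mul1r.
  rewrite andbT andbF mul0r addr0.
  by case: (b =P a) => // _ /eqP; rewrite mulr0 (negPf nu0).
rewrite [LHS]HF_coord_expand [X in _ + X](_ : _ =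
    \sum_g (HF_coord g 1 y : k) *: (iota g * x)); last first.
  rewrite (bigD1 1%g) //= (HF_iota1 ax) mul1r big1 ?addr0 // => g /low ->.
  by rewrite scale0r.
rewrite -big_split; apply: eq_bigr => g _ /=.
rewrite (bigD1 (Ordinal (ltnW p_gt1))) //= (bigD1 (Ordinal p_gt1)) //=.
rewrite mulr1 expr1 big1 ?addr0 // => i /andP[].
rewrite -!val_eqE /= => i0 i1.
by rewrite high ?scale0r // ltn_neqAle eq_sym i1 lt0n.
Qed.

(** Conjugation preserves kG, and it changes chi(h) x only by a multiple of
    a - 1, also in kG. *)
Lemma HF_coord_conj (mu : G -> k) (nu : k) h :
  HF_coord 1%g 1 (iota h * (\sum_g mu g *: iota g + nu *: x) * iota h^-1%g)
    = d_chi F h * nu.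
Proof.
rewrite mulrDr mulrDl -scalerAr -scalerAl (HF_conj ax) mulr_sumr mulr_suml.
rewrite linearD linear_sum big1 /= ?add0r => [|g _]; last first.
  rewrite -scalerAr -scalerAl -!(HF_iotaM ax) linearZ /= HF_coord_iota.
  by rewrite andbF scaler0.
rewrite linearZ linearD !linearZ linearB /= -(HF_iota1 ax) !HF_coord_iota.
rewrite !andbF subr0 scaler0 addr0 -[x in HF_coord _ _ x]mul1r -(HF_iota1 ax).
rewrite -[x in _ * x]expr1 HF_coordE ?p_gt1 // !eqxx.
by rewrite /GRing.scale /= mulr1 mulrC.
Qed.

End RankOneHopf.

(** * Isomorphisms *)

Section DatumMorphism.

Variables (k : fieldType) (p : nat) (G G' : finGroupType).
Variables (F : datum k G) (F' : datum k G') (H : HFType p F) (H' : HFType p F').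
Hypotheses (charp : p \in [pchar k]).
Variable f : G -> G'.
Hypotheses (fM : {morph f : g h / (g * h)%g}).
Hypotheses (fa : f (d_a F) = d_a F') (fchi : d_chi F =1 d_chi F' \o f).
Hypotheses (fc : d_c F =1 d_c F' \o f) (falpha : d_alpha F = d_alpha F').

(** The elements u with phi (u v) = phi u phi v for all v are closed under
    products and linear combinations, so that multiplicativity follows from the
    cases u in G and u = x. *)
Lemma datum_morphism_lrmorphism : exists phi : {lrmorphism H -> H'},
  (forall g, phi (HF_grp H g) = HF_grp H' (f g)) /\ phi (HF_gen H) = HF_gen H'.
Proof.
have [ax ax'] := (HF_ax H, HF_ax H').
have p1 := p_gt1 charp.
have f1 : f 1%g = 1%g by apply: (mulgI (f 1%g)); rewrite -fM !mulg1.
have fX g n : f (g ^+ n)%g = (f g ^+ n)%g.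
  by elim: n => [//|n IHn]; rewrite !expgS fM IHn.
have fV g : f g^-1%g = (f g)^-1%g.
  by apply: (mulgI (f g)); rewrite -fM !mulgV.
have [phi phiE] := basis_lin (HF_basis ax)
  (fun u : G * 'I_p => HF_grp H' (f u.1) * HF_gen H' ^+ u.2).
have {}phiE g i : (i < p)%N ->
    phi (HF_grp H g * HF_gen H ^+ i) = HF_grp H' (f g) * HF_gen H' ^+ i.
  by move=> ltip; rewrite (phiE (g, Ordinal ltip)).
have phi_iota g : phi (HF_grp H g) = HF_grp H' (f g).
  by have := phiE g 0%N (ltnW p1); rewrite !expr0 !mulr1.
have phi1 : phi 1 = 1 by rewrite -(HF_iota1 ax) phi_iota f1 (HF_iota1 ax').
have phi_x : phi (HF_gen H) = HF_gen H'.
  have := phiE 1%g 1%N p1.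
  by rewrite f1 (HF_iota1 ax) (HF_iota1 ax') !expr1 !mul1r.
have phi_iotaM g u : phi (HF_grp H g * u) = HF_grp H' (f g) * phi u.
  apply: (HF_ext (f := phi \o (HF_grp H g \*o idfun))
                 (g := HF_grp H' (f g) \*o phi)) => h i /=.
  by rewrite mulrA -(HF_iotaM ax) !phiE // fM (HF_iotaM ax') mulrA.
have phi_X i : (i < p)%N -> phi (HF_gen H ^+ i) = HF_gen H' ^+ i.
  move=> ltip; rewrite -[LHS]/(phi (HF_gen H ^+ i)) -[_ ^+ i]mul1r.
  by rewrite -(HF_iota1 ax) phiE // f1 (HF_iota1 ax') mul1r.
(* For i = p - 1 this is where the formulas for x^p have to agree. *)
have phi_expS i : (i < p)%N ->
    phi (HF_gen H * HF_gen H ^+ i) = HF_gen H' * HF_gen H' ^+ i.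
  rewrite -!exprS leq_eqVlt => /predU1P[->|ltip]; last exact: phi_X.
  rewrite (HF_xp ax) (HF_xp ax') linearD !linearZ /= -falpha phi_x.
  by rewrite linearB /= -!HF_iotaX phi_iota phi1 fX fa.
have phi_xM u : phi (HF_gen H * u) = HF_gen H' * phi u.
  apply: (HF_ext (f := phi \o (HF_gen H \*o idfun))
                 (g := HF_gen H' \*o phi)) => h i /=.
  rewrite phiE // !mulrA !HF_gen_iota -!mulrA phi_iotaM; congr (_ * _).
  rewrite !mulrDl linearD -!scalerAl !linearZ /= phi_expS // !mulrBl linearB /=.
  rewrite phi_iotaM fa fchi fc /= fV.
  by rewrite !mul1r phi_X.
have phiM : monoid_morphism phi.
  split=> // u v; move: u.
  apply: (HF_ext (f := phi \o (v \o* idfun)) (g := phi v \o* phi)) => h i /=.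
  rewrite phiE // -!mulrA phi_iotaM; congr (_ * _).
  elim: (val i) => [|n IHn]; first by rewrite !expr0 !mul1r.
  by rewrite !exprS -!mulrA phi_xM IHn.
pose phiMM := GRing.isMonoidMorphism.Build _ _ _ phiM.
pose phiL : {lrmorphism H -> H'} := HB.pack (phi : H -> H') phiMM phi.
by exists phiL.
Qed.

End DatumMorphism.

Section Isomorphism.

Variables (k : fieldType) (p : nat) (G G' : finGroupType).
Variables (F : datum k G) (F' : datum k G') (H : HFType p F) (H' : HFType p F').
Hypotheses (charp : p \in [pchar k]).
Hypotheses (axF : datum_axioms p F) (axF' : datum_axioms p F').

Lemma datum_isom_hopf_isomorphic (f : {morphism [set: G] >-> G'}) :
    isom [set: G] [set: G'] f -> f (d_a F) = d_a F' ->
    d_chi F =1 d_chi F' \o f -> d_c F =1 d_c F' \o f ->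
  d_alpha F = d_alpha F' -> hopf_isomorphic H H'.
Proof.
move=> /isomP[/injmP finj fim] fa fchi fc falpha.
have [ax ax'] := (HF_ax H, HF_ax H').
have fM : {morph f : g h / (g * h)%g} by move=> g h; rewrite morphM ?inE.
have fV g : f g^-1%g = (f g)^-1%g by rewrite morphV ?inE.
have fX g n : f (g ^+ n)%g = (f g ^+ n)%g by rewrite morphX ?inE.
have [f' fK f'K] : bijective f.
  apply: inj_card_bij => [g h|]; first by apply: finj; rewrite ?inE.
  by rewrite -!cardsT -fim leq_morphim.
have [phi [phi_iota phi_x]] :=
  datum_morphism_lrmorphism H H' charp fM fa fchi fc falpha.
have [psi [psi_iota psi_x]] : exists psi : {lrmorphism H' -> H},
    (forall g, psi (HF_grp H' g) = HF_grp H (f' g)) /\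
    psi (HF_gen H') = HF_gen H.
  apply: datum_morphism_lrmorphism => //.
  - by move=> g h; apply: (can_inj fK); rewrite fM !f'K.
  - by rewrite -fa fK.
  - by move=> g; rewrite /= fchi /= f'K.
  - by move=> g; rewrite /= fc /= f'K.
have phiE g i :
    phi (HF_grp H g * HF_gen H ^+ i) = HF_grp H' (f g) * HF_gen H' ^+ i.
  by rewrite rmorphM rmorphXn /= phi_iota phi_x.
exists phi; split.
- exists psi.
    apply: (HF_ext (f := psi \o phi) (g := idfun)) => h i /=.
    by rewrite phiE rmorphM rmorphXn /= psi_iota psi_x fK.
  apply: (HF_ext (f := phi \o psi) (g := idfun)) => h i /=.
  by rewrite rmorphM rmorphXn /= psi_iota psi_x phiE f'K.
- apply: (HF_ext (f := comul \o phi) (g := tmap phi phi \o comul)) => h i /=.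
  rewrite phiE !HF_comul_expand // linear_sum; apply: eq_bigr => j _.
  by rewrite linearZ /= tmap_tens /= !phiE fM fX fa.
- apply: (HF_ext (f := counit \o phi) (g := counit)) => h i /=.
  by rewrite phiE (HF_counit ax) (HF_counit ax').
apply: (HF_ext (f := antipode \o phi) (g := phi \o antipode)) => h i /=.
rewrite phiE (HF_antipode ax) (HF_antipode ax') rmorphM rmorphXn rmorphN /=.
by rewrite rmorphM /= !phi_iota phi_x !fV fa.
Qed.

Lemma hopf_isomorphic_datum_isom : hopf_isomorphic H H' ->
   exists f : {morphism [set: G] >-> G'},
     [/\ isom [set: G] [set: G'] f,
         f (d_a F) = d_a F'
       & d_chi F =1 d_chi F' \o f].
Proof.
case=> phi [[psi phiK psiK] phi_comul _ _].
have [ax ax'] := (HF_ax H, HF_ax H').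
have psi_lin : linear psi by apply: can2_linear phiK psiK.
pose psiL : {linear H' -> H} :=
  HB.pack psi (GRing.isLinear.Build _ _ _ _ _ psi_lin).
have psi_comul := can_comul (psi := psiL) phiK psiK phi_comul.
have /fin_all_exists[f fE] g : exists g', phi (HF_grp H g) = HF_grp H' g'.
  apply: (grouplike_HF charp axF').
    by rewrite -(can_eq psiK) phiK -[psi 0]/(psiL 0) linear0 HF_iota_neq0.
  by rewrite phi_comul HF_comul_iota // tmap_tens.
have /fin_all_exists[f' f'E] g' : exists g, psiL (HF_grp H' g') = HF_grp H g.
  apply: (grouplike_HF charp axF).
    by rewrite -(can_eq phiK) psiK linear0 HF_iota_neq0.
  by rewrite psi_comul HF_comul_iota // tmap_tens.
have fK : cancel f f'.
  by move=> g; apply: (HF_iota_inj (H := H) charp); rewrite -f'E -fE /= phiK.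
have f'K : cancel f' f.
  by move=> g; apply: (HF_iota_inj (H := H') charp); rewrite -fE -f'E /= psiK.
have fM : {morph f : g h / (g * h)%g}.
  move=> g h; apply: (HF_iota_inj (H := H') charp).
  by rewrite (HF_iotaM ax') -!fE (HF_iotaM ax) rmorphM.
pose fm := Morphism (D := [set: G]) (fun g h _ _ => fM g h).
have fV g : f g^-1%g = (f g)^-1%g by rewrite -[f]/(fm : G -> G') morphV ?inE.
have comul_x : comul (phi (HF_gen H)) =
    phi (HF_gen H) \ox HF_grp H' (f (d_a F)) + 1 \ox phi (HF_gen H).
  rewrite phi_comul (HF_comul_gen _ charp) linearD /= !tmap_tens /=.
  by rewrite rmorph1 fE.
have [y_low|[fa nu0 yE]] := skew_primitive_HF charp axF' comul_x.
  (* Here phi x lies in kG' = phi (kG), so that x would lie in kG. *)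
  have xE : HF_gen H =
      \sum_g (HF_coord H' g 0 (phi (HF_gen H)) : k) *: HF_grp H (f' g).
    apply: (can_inj phiK); rewrite linear_sum.
    rewrite [LHS](HF_coord_low charp y_low); apply: eq_bigr => g _.
    by rewrite linearZ /= fE f'K.
  have /(congr1 (HF_coord H 1%g 1)) := xE.
  rewrite linear_sum big1 => [|g _] /=.
    rewrite -[HF_gen H]mul1r -(HF_iota1 ax) -[HF_gen H]expr1.
    by rewrite HF_coordE ?(p_gt1 charp) // !eqxx => /eqP; rewrite oner_eq0.
  rewrite linearZ /= HF_coord_iota // andbF.
  exact: mulr0.
exists fm; split=> //.
  apply/isomP; split; first by apply/injmP=> g h _ _; apply: (can_inj fK).
  apply/setP=> g'; rewrite inE; apply/morphimP.
  by exists (f' g'); rewrite ?inE //= f'K.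
(* Coefficient of x' in phi (g x g^-1), computed in H_F' and in H_F. *)
move=> g /=; apply: (mulIf nu0).
rewrite -(HF_coord_conj H' charp (fun h => HF_coord H' h 0 (phi (HF_gen H)))).
rewrite -yE -fV -!fE -!rmorphM /= (HF_conj ax).
rewrite linearP linearZ /= rmorphB rmorph1 /= fE.
rewrite linearP linearZ /= linearB /=.
rewrite -(HF_iota1 ax') !HF_coord_iota // !andbF subrr.
by rewrite -[LHS]addr0; congr (_ + _); rewrite /GRing.scale /= mulr0.
Qed.

End Isomorphism.

Theorem lemma3p17 (k : fieldType) (p : nat) (G G' : finGroupType)
    (F : datum k G) (F' : datum k G') (HF : HFType p F) (HF' : HFType p F') :
  p \in [pchar k] -> datum_axioms p F -> datum_axioms p F' ->
  ((exists f : {morphism [set: G] >-> G'},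
      [/\ isom [set: G] [set: G'] f,
          f (d_a F) = d_a F',
          d_chi F =1 d_chi F' \o f,
          d_c F =1 d_c F' \o f
        & d_alpha F = d_alpha F']) ->
   hopf_isomorphic HF HF')
  /\
  (hopf_isomorphic HF HF' -> nilpotent_type HF -> nilpotent_type HF' ->
   #[d_a F]%g != p ->
   exists f : {morphism [set: G] >-> G'},
     [/\ isom [set: G] [set: G'] f,
         f (d_a F) = d_a F'
       & d_chi F =1 d_chi F' \o f]).
Proof.
move=> charp axF axF'; split.
  case=> f [fiso fa fchi fc falpha].
  exact: (datum_isom_hopf_isomorphic _ _ charp axF axF' fiso).
by move=> HH' _ _ _; exact: (hopf_isomorphic_datum_isom charp axF axF' HH').
Qed.
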